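(* Let $m\ge 1$ and $n=3m$. The cyclic conformation $\bullet\circ\circ\bullet\circ\circ\cdots\bullet\circ\circ=(\bullet\circ\circ)^m$ with $n$ pawns has reducibility value $n/3$ for solitaire Clobber on the cycle.
   Context: Solitaire Clobber on a cycle: an initial conformation is a cyclic word $c=c_1\cdots c_n$ ($n\ge 3$), $c_i\in\{\bullet,\circ\}$; a pawn of color $c_i$ (black $\bullet$ or white $\circ$) is placed on position $i$, for each $i\in\mathbb Z/n\mathbb Z$, and positions $i$ and $i+1$ (indices modulo $n$) are adjacent. A legal move consists in moving a pawn from its position onto an adjacent position occupied by a pawn of the opposite color; that latter pawn is removed, and the position left becomes empty. The single player may move a pawn of either color at each turn. The reducibility value of $c$ is the smallest number of remaining pawns that can be obtained by a finite sequence of legal moves starting from $c$. *)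

(* Defs.v *)
From mathcomp Require Import all_boot.

Set Implicit Arguments.
Unset Strict Implicit.
Unset Printing Implicit Defensive.

Definition color : finType := bool.
Definition black : color := true.
Definition white : color := false.

(* ['I_n] stands for Z/nZ: [ordS] is the cyclic successor. *)
Definition adjacent n (i j : 'I_n) : bool := (j == ordS i) || (i == ordS j).

(* [p i = Some a]: a pawn of color [a] on [i]; [p i = None]: [i] is empty. *)
Definition configuration n : finType := {ffun 'I_n -> option color}.

Definition initial n (c : n.-tuple color) : configuration n :=
  [ffun i => Some (tnth c i)].

Definition pawns n (p : configuration n) : nat := #|[set i | p i != None]|.

Definition after_move n (p : configuration n) (i j : 'I_n) : configuration n :=
  [ffun k => if k == i then None else if k == j then p i else p k].

Definition legal n (p : configuration n) (i j : 'I_n) : bool :=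
  adjacent i j &&
  [exists a : color, (p i == Some a) && (p j == Some (~~ a))].

Definition move n : rel (configuration n) := fun p q =>
  [exists i, exists j, legal p i j && (q == after_move p i j)].

(* [connect] is the reflexive transitive closure, so the minimum ranges over
   all configurations obtained by a finite (possibly empty) sequence of moves. *)
Definition reducibility_value n (c : n.-tuple color) : nat :=
  pawns [arg min_(p < initial c | connect (@move n) (initial c) p) pawns p].

(* Main.v *)
Require Import Defs.
From mathcomp Require Import all_boot.
From mathcomp Require Import zify.

(** For the upper bound, the black pawn of each block takes the two white pawns
    to its right.  For the lower bound, say that a pawn has absorbed all the
    initial pawns that ended up on its position, itself included.  A position is
    never refilled, so a moving pawn keeps its direction and goes through initial
    pawns of the other color, except that at its last stop it may meet a pawn
    that came the opposite way.  In this word, a pawn thus absorbs at most one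
    more white pawn than black pawns.  Since the white pawns outnumber the black
    ones by [m], at least [m] pawns remain. *)

Set Implicit Arguments.
Unset Strict Implicit.
Unset Printing Implicit Defensive.

(* Local invariant of a pawn of color [a] on a position congruent to [r] mod 3,
   that has absorbed [w] white and [b] black pawns; [L] and [R] tell whether
   the neighbors on its left and on its right are occupied.  A pawn that still
   has a neighbor has arrived from at most one side; if its color is not the
   initial one, it comes from the side of the empty neighbor.  The bound
   [w <= b] for [r = 1] (resp. [r = 2]) is the case of a black pawn that has
   come from the left (resp. right) and taken a single white pawn. *)
Definition tame (r : nat) (a : color) (L R : bool) (w b : nat) : bool :=
  (w <= b.+1) &&
  ((L || R) ==>
    if a == (r == 0) then a ==> (w < b)
    else ~~ (L && R) &&
      (if r == 0 then w <= b else if r == 1 then L || (w <= b) else R || (w <= b))).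

(** A move only empties positions, so a pawn not involved in it can only lose neighbors, which
    relaxes its constraints. *)
Lemma tame_mono r a (L R L' R' : bool) w b :
  (L' -> L) -> (R' -> R) -> tame r a L R w b -> tame r a L' R' w b.
Proof.
rewrite /tame; case: (r == 0) (r == 1) a L R L' R' => [] [] [] [] [] [] [] //= hL hR;
  try (by have := hL isT); try (by have := hR isT); lia.
Qed.

(** Each pawn is a neighbor of the other, so the sharper bounds of [tame] apply to both. In every
    case at least one of the two has absorbed no more white pawns than black ones, so the total
    excess is at most one. *)
Lemma tame_merge_right r s a L R w b w' b' :
  r < 3 -> s = r.+1 %% 3 ->
  tame r a L true w b -> tame s (~~ a) true R w' b' ->
  tame s a false R (w + w') (b + b').
Proof.
by case: r => [|[|[|//]]] _ -> {s}; rewrite /tame /=; case: a L R => [] [] [] /=; lia.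
Qed.

Lemma tame_merge_left r s a L R w b w' b' :
  s < 3 -> r = s.+1 %% 3 ->
  tame r a true R w b -> tame s (~~ a) L true w' b' ->
  tame s a L false (w + w') (b + b').
Proof.
by case: s => [|[|[|//]]] _ -> {r}; rewrite /tame /=; case: a L R => [] [] [] /=; lia.
Qed.

(** * The invariant of a configuration and the pawn count it forces *)

Definition occupied n (p : configuration n) (i : 'I_n) : bool := p i != None.

Definition merge n (i j : 'I_n) (f : 'I_n -> nat) (k : 'I_n) : nat :=
  if k == i then 0 else if k == j then f i + f j else f k.

Lemma sum_merge n (i j : 'I_n) (f : 'I_n -> nat) :
  i != j -> \sum_k merge i j f k = \sum_k f k.
Proof.
move=> ij; have ji : j != i by rewrite eq_sym.
rewrite [LHS](bigD1 i) // [RHS](bigD1 i) //= (bigD1 j) //= [in RHS](bigD1 j) //=.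
rewrite /merge eqxx (negbTE ji) eqxx add0n -addnA; congr (_ + (_ + _)).
by apply: eq_bigr => k /andP[/negbTE-> /negbTE->].
Qed.

Lemma occupied_after_move n (p : configuration n) (i j k : 'I_n) :
  legal p i j -> occupied (after_move p i j) k = (k != i) && occupied p k.
Proof.
move=> /andP[_ /existsP[a /andP[/eqP pi /eqP pj]]].
by rewrite /occupied ffunE; have [//|_] := eqVneq k i; have [->|//] := eqVneq k j; rewrite pi pj.
Qed.

Lemma pawns_after_move n (p : configuration n) (i j : 'I_n) :
  legal p i j -> pawns p = (pawns (after_move p i j)).+1.
Proof.
move=> lij; rewrite /pawns (cardsD1 i) inE.
have -> : p i != None by case/andP: lij => _ /existsP[a /andP[/eqP->]].
rewrite add1n; congr _.+1; apply: eq_card => k.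
by rewrite !inE -!/(occupied _ _) (occupied_after_move _ lij).
Qed.

Definition tame_at n (p : configuration n) (w b : 'I_n -> nat) (k : 'I_n) : Prop :=
  if p k is Some a then
    tame (k %% 3) a (occupied p (ord_pred k)) (occupied p (ordS k)) (w k) (b k)
  else w k = 0.

Definition balanced m n (p : configuration n) : Prop :=
  exists w b : 'I_n -> nat,
    [/\ \sum_k w k = 2 * m, \sum_k b k = m & forall k, tame_at p w b k].

(** Summing [w k <= b k + 1] over the pawns, and [w k = 0] elsewhere, yields
    [2 * m <= m + pawns p]. *)
Lemma balanced_pawns m n (p : configuration n) : balanced m p -> m <= pawns p.
Proof.
move=> [w [b [sw sb pwb]]].
have: \sum_k w k <= \sum_k (b k + occupied p k).
  apply: leq_sum => k _; have := pwb k; rewrite /tame_at /occupied.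
  by case: (p k) => [a /andP[h _]|->] //=; rewrite addn1.
rewrite big_split /= sw sb => h.
have -> : pawns p = \sum_k occupied p k by rewrite /pawns -sum1dep_card big_mkcond.
by rewrite -(leq_add2l m) addnn -mul2n.
Qed.

(** * Lower bound: the invariant along moves and at the start *)

Section MultipleOfThree.

Variables (m n : nat).
Hypothesis n3m : n = 3 * m.

(** The wrap-around respects residues because 3 divides [n]. *)
Lemma modn3_ordS (i : 'I_n) : ordS i %% 3 = (i %% 3).+1 %% 3.
Proof.
rewrite /= modn_dvdm; last by rewrite n3m dvdn_mulr.
by rewrite -addn1 -modnDml addn1.
Qed.

Lemma ordS_neq (i : 'I_n) : ordS i != i.
Proof.
by apply/eqP => e; have := modn3_ordS i; rewrite e; lia.
Qed.

Lemma legal_neq (p : configuration n) (i j : 'I_n) : legal p i j -> i != j.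
Proof.
by case/andP=> /orP[]/eqP-> _; rewrite ?ordS_neq // eq_sym ordS_neq.
Qed.

Lemma balanced_move (p q : configuration n) :
  move p q -> balanced m p -> balanced m q.
Proof.
move=> /existsP[i /existsP[j /andP[lij /eqP->]]] [w [b [sw sb pwb]]].
have ij := legal_neq lij; have ji : j != i by rewrite eq_sym.
exists (merge i j w), (merge i j b).
split; rewrite ?sum_merge // => k.
have occ' x := occupied_after_move x lij.
rewrite /tame_at /merge !occ' ffunE.
have [//|ki] := eqVneq k i.
have [->|kj] := eqVneq k j; last first.
  have := pwb k; rewrite /tame_at; case: (p k) => [a|//].
  by apply: tame_mono => /andP[].
case/andP: lij => adj /existsP[a /andP[/eqP pi /eqP pj]].
have oi : occupied p i by rewrite /occupied pi.
have oj : occupied p j by rewrite /occupied pj.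
have := pwb j; have := pwb i; rewrite /tame_at pi pj.
case/orP: adj => /eqP e.
- rewrite e ordSK -e oi oj => ti tj.
  (* The left neighbor of [j] is the position [i] just vacated, hence the flag [false]. *)
  apply: (@tame_mono _ _ false (occupied p (ordS j))) => [|/andP[//]|].
    by rewrite eqxx.
  by apply: tame_merge_right ti tj; rewrite ?ltn_pmod // e modn3_ordS.
- rewrite e ordSK -e oi oj => ti tj.
  apply: (@tame_mono _ _ (occupied p (ord_pred j)) false) => [/andP[//]||].
    by rewrite eqxx.
  by apply: tame_merge_left ti tj; rewrite ?ltn_pmod // e modn3_ordS.
Qed.

Lemma balanced_connect (p q : configuration n) :
  connect (@move n) p q -> balanced m p -> balanced m q.
Proof.
move=> /connectP[s ps ->] {q}.
elim: s p ps => //= q s IH p /andP[pq qs] bp.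
by apply: IH qs _; apply: balanced_move pq bp.
Qed.

Variable c : n.-tuple color.
Hypothesis c_blocks : c = flatten (nseq m [:: black; white; white]) :> seq color.

Lemma tnth_blocks (i : 'I_n) : tnth c i = (i %% 3 == 0).
Proof.
rewrite (tnth_nth white) c_blocks.
have: i < 3 * m by rewrite -n3m.
move: (i : nat) => {i} i; elim: m i => [|k IH] i; first by rewrite muln0.
case: i => [|[|[|i]]] //= lt_i.
rewrite IH; last by lia.
by congr (_ == 0); lia.
Qed.

Lemma count_blocks a : count_mem a c = if a then m else 2 * m.
Proof.
rewrite c_blocks; elim: m => [|k IH]; first by case: a.
by rewrite /= IH; case: a {IH}; rewrite /black /white /=; lia.
Qed.

Lemma sum_color a : \sum_(k < n) (tnth c k == a) = if a then m else 2 * m.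
Proof.
by rewrite -count_blocks -sum1_count big_tuple [RHS]big_mkcond.
Qed.

(** Each pawn has absorbed only itself and has its initial color, so beyond [w <= b.+1] only [0 < 1]
    is asked, of the black pawns. *)
Lemma balanced_initial : balanced m (initial c).
Proof.
exists (fun k => tnth c k == white), (fun k => tnth c k == black).
split; rewrite ?sum_color // => k.
by rewrite /tame_at ffunE /tame -tnth_blocks eqxx; case: (tnth c k); rewrite /= ?implybT.
Qed.

(** * Upper bound: reducing the blocks one at a time *)

Definition first_blocks_reduced (k : nat) : configuration n :=
  [ffun i : 'I_n => if i < 3 * k then (if i %% 3 == 2 then Some black else None)
             else Some (tnth c i)].

Lemma first_blocks_reduced_step k : k < m ->
  connect (@move n) (first_blocks_reduced k) (first_blocks_reduced k.+1) /\
  pawns (first_blocks_reduced k) = pawns (first_blocks_reduced k.+1) + 2.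
Proof.
move=> km.
have h0 : 3 * k < n by lia.
have h1 : (3 * k).+1 < n by lia.
have h2 : (3 * k).+2 < n by lia.
pose i0 := Ordinal h0; pose i1 := Ordinal h1; pose i2 := Ordinal h2.
have e1 : i1 = ordS i0 by apply: val_inj; rewrite /= modn_small.
have e2 : i2 = ordS i1 by apply: val_inj; rewrite /= modn_small.
(* The black pawn of the block goes from [i0] to [i1], then to [i2]. *)
pose p1 := after_move (first_blocks_reduced k) i0 i1.
have l0 : legal (first_blocks_reduced k) i0 i1.
  rewrite /legal /adjacent e1 eqxx /= -e1; apply/existsP; exists black.
  rewrite !ffunE !tnth_blocks /=.
  by rewrite ltnn ltnNge leqnSn /= modnMr -addn1 mulnC modnMDl.
have l1 : legal p1 i1 i2.
  rewrite /legal /adjacent e2 eqxx /= -e2; apply/existsP; exists black.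
  rewrite !ffunE !tnth_blocks -!(inj_eq val_inj) /=.
  have -> : (3 * k < 3 * k) = false by lia.
  have -> : ((3 * k).+2 < 3 * k) = false by lia.
  have -> : ((3 * k).+1 == 3 * k) = false by lia.
  have -> : ((3 * k).+2 == 3 * k) = false by lia.
  have -> : ((3 * k).+2 == (3 * k).+1) = false by lia.
  have -> : (3 * k).+2 %% 3 = 2 by lia.
  by rewrite eqxx modnMr.
have e : after_move p1 i1 i2 = first_blocks_reduced k.+1.
  apply/ffunP => i; rewrite !ffunE !tnth_blocks -!(inj_eq val_inj) /=.
  have -> : (3 * k < 3 * k) = false by lia.
  have -> : ((3 * k).+1 == 3 * k) = false by lia.
  rewrite eqxx modnMr eqxx.
  (* The three positions of the block are compared one by one; elsewhere the thresholds [3 * k] and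
     [3 * k.+1] agree. *)
  have [->|n1] := eqVneq (i : nat) (3 * k).+1.
    have -> : (3 * k).+1 %% 3 = 1 by lia.
    by have -> : (3 * k).+1 < 3 * k.+1 by lia.
  have [->|n2] := eqVneq (i : nat) (3 * k).+2.
    have -> : (3 * k).+2 %% 3 = 2 by lia.
    by have -> : (3 * k).+2 < 3 * k.+1 by lia.
  have [->|n0] := eqVneq (i : nat) (3 * k).
    by rewrite modnMr; have -> : 3 * k < 3 * k.+1 by lia.
  by have -> : (i < 3 * k.+1) = (i < 3 * k) by lia.
split; last by rewrite (pawns_after_move l0) (pawns_after_move l1) e addn2.
apply: (@connect_trans _ _ p1); apply: connect1.
  by apply/existsP; exists i0; apply/existsP; exists i1; rewrite l0 eqxx.
by apply/existsP; exists i1; apply/existsP; exists i2; rewrite l1 e eqxx.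
Qed.

Lemma connect_first_blocks_reduced k : k <= m ->
  connect (@move n) (initial c) (first_blocks_reduced k) /\
  pawns (first_blocks_reduced k) + 2 * k = n.
Proof.
have e0 : first_blocks_reduced 0 = initial c by apply/ffunP => i; rewrite !ffunE.
elim: k => [_|k IH km].
  rewrite e0 connect0 addn0; split=> //.
  by rewrite -[RHS]card_ord -cardsT; apply: eq_card => i; rewrite !inE ffunE.
have [ck pk] := IH (ltnW km); have [cs ps] := first_blocks_reduced_step km.
by split; [apply: connect_trans ck cs | lia].
Qed.

Lemma reducibility_value_blocks : reducibility_value c = m.
Proof.
rewrite /reducibility_value; case: arg_minnP => [|p cp minp]; first exact: connect0.
apply/eqP; rewrite eqn_leq (balanced_pawns (balanced_connect cp balanced_initial)) andbT.
(* With all blocks reduced, [n - 2 * m = m] pawns are left. *)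
have [cm pm] := connect_first_blocks_reduced (leqnn m).
by apply: leq_trans (minp _ cm) _; lia.
Qed.

End MultipleOfThree.

Theorem theorem13 (m n : nat) (c : n.-tuple color) :
  1 <= m -> n = 3 * m ->
  c = flatten (nseq m [:: black; white; white]) :> seq color ->
  reducibility_value c = n %/ 3.
Proof.
move=> _ n3m cE.
by rewrite (reducibility_value_blocks n3m cE) n3m mulKn.
Qed.
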